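(* Consider the distance-$2$ firefighter game on the infinite square grid $G_{\square}$ with two firefighters. If the two firefighters can corral the fire to a column of finite width, then they can contain the fire.
   Context: $G_{\square}$ is the infinite square grid: vertex set $\mathbb{Z}\times\mathbb{Z}$, with two vertices adjacent if and only if they differ by exactly $1$ in one coordinate and agree in the other. Distance-$2$ firefighter game with two firefighters: on turn $0$, a finite nonempty set of vertices starts burning, and then the two firefighters are placed on unburnt vertices (both may occupy the same vertex), protecting the vertices they occupy. On each turn $t+1$ ($t\ge 0$), first the fire spreads to every unburnt, unprotected neighbour of every burning vertex; then each firefighter moves from its current vertex to an unburnt vertex at distance at most $2$ (possibly staying put, and both may occupy the same vertex), where the distance is measured in the subgraph induced by the currently unburnt vertices (firefighters may not move through the fire), and protects the vertex it arrives at. Once a vertex is burning or protected it remains so for the rest of the game. The fire is contained if after finitely many turns a point is reached where the fire can no longer spread (no burning vertex has an unburnt, unprotected neighbour). The firefighters ''can contain the fire'' if, for the given initial set of burning vertices, they have a sequence of valid placements and moves that contains it. Corralling to a column: the two firefighters can corral the fire (for the given initial set of burning vertices) to a column if they have a sequence of valid placements and moves such that, possibly after applying a symmetry of the grid, there are a turn $T$ (when the corralling has begun) and integers $x_0<x_1$ and $y_0<y_1$ such that for every $t\ge 0$ the firefighters on turn $T+t$ are defending $(x_0,y_0+t)$ and $(x_1,y_1+t)$, and, if the firefighters continue with this strategy forever, no new vertex (i.e. no vertex not already burnt at turn $T$) of the form $(x,y)$ with $x\notin[x_0,x_1]$ and $y>y_1$, or of the form $(x,y)$ with $y<y_0$,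 will ever burn. *)

(* Defs.v *)
From mathcomp Require Import all_boot all_order all_algebra.
From mathcomp Require Import classical_sets cardinality.

Set Implicit Arguments.
Unset Strict Implicit.
Unset Printing Implicit Defensive.

Import Order.TTheory GRing.Theory Num.Theory.
Local Open Scope classical_set_scope.
Local Open Scope ring_scope.

Definition vertex : Type := (int * int)%type.

Definition adj : rel vertex := fun u v =>
  ((`|u.1 - v.1| == 1) && (u.2 == v.2)) ||
  ((u.1 == v.1) && (`|u.2 - v.2| == 1)).

Definition grid_symmetry (g : vertex -> vertex) : Prop :=
  bijective g /\ forall u v, adj (g u) (g v) = adj u v.

(* The distance between u and v in the subgraph induced by A is at most d. *)
Definition dist_le (A : set vertex) (d : nat) (u v : vertex) : Prop :=
  exists s : seq vertex,
    [/\ path adj u s, last u s = v, (size s <= d)%N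
      & forall w, w \in u :: s -> A w].

(* p t i is the vertex occupied by firefighter i at the end of turn t. *)
Definition strategy : Type := nat -> 'I_2 -> vertex.

Definition defended (p : strategy) (t : nat) : set vertex := range (p t).

Definition protected (p : strategy) (t : nat) : set vertex :=
  [set v | exists2 s, (s <= t)%N & defended p s v].

Fixpoint burnt (S : set vertex) (p : strategy) (t : nat) : set vertex :=
  if t is t'.+1 then
    burnt S p t' `|`
    [set v | ~ protected p t' v /\ exists2 u, burnt S p t' u & adj u v]
  else S.

(* On turn t+1 the fire spreads before the firefighters move, so a move must
   avoid the vertices that are burnt on turn t+1. *)
Definition valid (S : set vertex) (p : strategy) : Prop :=
  (forall i, ~ S (p 0%N i)) /\
  (forall t i, dist_le (~` burnt S p t.+1) 2 (p t i) (p t.+1 i)).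

Definition contained_at (S : set vertex) (p : strategy) (t : nat) : Prop :=
  forall u v, burnt S p t u -> adj u v -> burnt S p t v \/ protected p t v.

(* An infinite sequence of moves is harmless here: a firefighter can always
   stay put, since the vertex it protects never burns. *)
Definition can_contain (S : set vertex) : Prop :=
  exists2 p, valid S p & exists t, contained_at S p t.

Definition can_corral (S : set vertex) : Prop :=
  exists (p : strategy) (g : vertex -> vertex) (T : nat) (x0 x1 y0 y1 : int),
    [/\ valid S p, grid_symmetry g, x0 < x1 /\ y0 < y1,
        (forall t : nat,
           g @` defended p (T + t) = [set (x0, y0 + t%:Z); (x1, y1 + t%:Z)])
      & forall (t : nat) (v : vertex) (x y : int),
          g v = (x, y) ->
          (~~ (x0 <= x <= x1) /\ y1 < y) \/ y < y0 ->
          ~ burnt S p T v -> ~ burnt S p t v].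

(* Main.v *)
Require Import Defs.
From mathcomp Require Import all_boot all_order all_algebra.
From mathcomp Require Import boolp classical_sets cardinality.
From mathcomp Require Import zify.

(** Once the corralled fire fills a column of width w, a cell (x, y) of the
column (coordinates relative to the left firefighter, with the right one at
(w, d)) cannot burn before time max(y - x, x + y - d - w) + 1: otherwise the
fire would have left the column sideways. So the fire may be ahead of both
firefighters, but only by a constant.

The left firefighter L just keeps climbing. The right firefighter R moves
diagonally outwards for s turns, then diagonally inwards for k < s turns up to a
point E. The fire cannot pass E before time 2s + 1, and it has to go around E
to reach the outer side of the inward diagonal, which gives R the time to leave
his wall open at its corner (w + s, d + s). From E he climbs two cells per
turn until he is above the fire, builds a horizontal roof back to the column of
L, runs along the roof to x = w + s and closes the wall downwards to the open
corner. Meanwhile L reaches the roof, runs along it and extends it from E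
to x = w + s just ahead of the fire. With c = 2(w + d), s = w + 8c and
k = 2w + 7c every cell of the wall is protected before the fire reaches it. *)

Set Implicit Arguments.
Unset Strict Implicit.
Unset Printing Implicit Defensive.

Import Order.TTheory GRing.Theory Num.Theory.
Local Open Scope classical_set_scope.
Local Open Scope ring_scope.

Lemma burnt_mono S p s t : (s <= t)%N -> burnt S p s `<=` burnt S p t.
Proof.
move=> /subnK <-; elim: (t - s)%N => [|n IH] v //= b.
by left; apply: IH.
Qed.

Lemma burnt_congr S p q t : (forall s i, (s < t)%N -> p s i = q s i) ->
  burnt S p t = burnt S q t.
Proof.
elim: t => [//|t IH] pq /=; rewrite IH => [|s i st]; last exact/pq/ltnW.
have -> : protected p t = protected q t; last by [].
apply/seteqP; split=> v [s st [i _ <-]]; exists s => //; exists i => //.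
  by rewrite pq.
by rewrite pq.
Qed.

Lemma adjP u v : adj u v ->
  [\/ v = (u.1 + 1, u.2), v = (u.1 - 1, u.2),
      v = (u.1, u.2 + 1) | v = (u.1, u.2 - 1)].
Proof.
case: u v => [x y] [x' y']; rewrite /adj /= => A.
have : (x' == x + 1) && (y' == y) || (x' == x - 1) && (y' == y) ||
  (x' == x) && (y' == y + 1) || (x' == x) && (y' == y - 1) by lia.
by case/orP=> [/orP[/orP[]|]|] /andP[/eqP-> /eqP->]; constructor.
Qed.

Definition in_box (n : nat) : set vertex :=
  [set v | `|v.1| <= n%:Z /\ `|v.2| <= n%:Z].

Lemma in_box_le m n : (m <= n)%N -> in_box m `<=` in_box n.
Proof. by move=> mn [x y] [/= h1 h2]; split=> /=; lia. Qed.

Lemma in_box_seq n : exists l : seq vertex, forall v, in_box n v -> v \in l.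
Proof.
pose r := [seq i%:Z - n%:Z | i <- iota 0 (2 * n).+1].
have rP x : `|x| <= n%:Z -> x \in r.
  move=> xn; apply/mapP; exists `|(x + n%:Z)%R|%N; last lia.
  by rewrite mem_iota; lia.
exists [seq (x, y) | x <- r, y <- r] => -[x y] [xr yr].
by apply/allpairsPdep; exists x, y; split=> //; apply: rP.
Qed.

Lemma seq_in_box (l : seq vertex) : exists n, forall v, v \in l -> in_box n v.
Proof.
elim: l => [|u l [n IH]]; first by exists 0%N.
exists (maxn n (maxn `|u.1| `|u.2|)) => v; rewrite inE => /orP[/eqP->|/IH].
  by case: u => x y; split=> /=; lia.
by apply: in_box_le; rewrite leq_maxl.
Qed.

Lemma burnt_in_box S p t : finite_set S -> exists n, burnt S p t `<=` in_box n.
Proof.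
move=> /finite_seqP[l ->]; elim: t => [|t [n IH]].
  by have [n nP] := seq_in_box l; exists n => v /nP.
exists n.+1 => v [/IH|[_ [[x y] /IH [/= u1 u2] /adjP]]].
  exact: in_box_le.
by case=> ->; split => /=; lia.
Qed.

Lemma positions_in_box (p : strategy) t :
  exists n, forall s i, (s <= t)%N -> in_box n (p s i).
Proof.
have [n nP] := seq_in_box [seq p s i | s <- iota 0 t.+1, i <- enum 'I_2].
exists n => s i st; apply: nP; apply/allpairsPdep; exists s, i.
by rewrite mem_iota mem_enum.
Qed.

Lemma contain_bounded S p n : valid S p ->
  (forall t, burnt S p t `<=` in_box n) -> can_contain S.
Proof.
move=> pv bn; exists p => //.
have [l lP] := in_box_seq n.
have [t tP] : exists t, forall v, v \in l ->
    forall s, burnt S p s v -> burnt S p t v.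
  elim: l {lP} => [|u l [t tP]]; first by exists 0%N.
  have [[s us]|nu] := EM (exists s, burnt S p s u).
    exists (maxn s t) => v; rewrite inE => /orP[/eqP-> _ _|vl r vr].
      by apply: burnt_mono us; rewrite leq_maxl.
    by apply: burnt_mono (tP _ vl _ vr); rewrite leq_maxr.
  exists t => v; rewrite inE => /orP[/eqP-> s us|]; last exact: tP.
  by case: nu; exists s.
exists t => u v ut uv; have [|np] := EM (protected p t v); [by right|left].
have vb : burnt S p t.+1 v by right; split=> //; exists u.
exact: tP (lP _ (bn _ _ vb)) _ vb.
Qed.

Lemma dist_le_via (A : set vertex) u m v : A u -> A m -> A v ->
  (m == u) || adj u m -> (m == v) || adj m v -> dist_le A 2 u v.
Proof.
move=> Au Am Av um mv.
exists ((if m == u then [::] else [:: m]) ++ (if m == v then [::] else [:: v])).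
move: um mv; do 2 case: eqP => [?|_] /=; subst=> // um mv; split=> //=;
  rewrite ?um ?mv // => z; rewrite !inE; do ?[case/orP]; move=> /eqP-> //.
Qed.

Lemma grid_symmetry_burnt g S p : grid_symmetry g -> forall t v,
  burnt (g @` S) (fun t i => g (p t i)) t (g v) <-> burnt S p t v.
Proof.
case=> -[h gK hK] gadj; have gI := can_inj gK.
have pP t v : protected (fun t i => g (p t i)) t (g v) <-> protected p t v.
  split=> -[s st [i _ e]]; exists s => //; exists i => //; last by rewrite e.
  exact: gI.
elim=> [|t IH] v /=; first by split=> [[u Su /gI <-]|Sv] //; exists v.
split=> -[/IH|[np [u ub uv]]]; [by left|right|by left|right].
  split; first by move=> /pP.
  by exists (h u); [apply/IH; rewrite hK|rewrite -gadj hK].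
split; first by move=> /pP.
by exists (g u); [apply/IH|rewrite gadj].
Qed.

Lemma grid_symmetry_valid g S p : grid_symmetry g -> valid S p ->
  valid (g @` S) (fun t i => g (p t i)).
Proof.
move=> gs; have gb := grid_symmetry_burnt S p gs.
have [[h gK hK] gadj] := gs; move=> [p0 pS]; split=> [i /= [u Su]|t i].
  by move=> /(can_inj gK) e; apply: (p0 i); rewrite -e.
have [s [sp sl ss sA]] := pS t i.
exists (map g s); split.
- by rewrite path_map; apply: sub_path sp => u v; rewrite /= gadj.
- by rewrite last_map sl.
- by rewrite size_map.
move=> w; rewrite -map_cons => /mapP[u us ->] /gb; exact: sA.
Qed.

Lemma grid_symmetry_contain g S : grid_symmetry g -> can_contain (g @` S) ->
  can_contain S.
Proof.
move=> [[h gK hK] gadj] [p pv [t pt]].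
have hs : grid_symmetry h.
  by split; [exists g|move=> u v; rewrite -gadj !hK].
have e : h @` (g @` S) = S.
  apply/seteqP; split=> [_ [_ [v Sv <-] <-]|v Sv]; first by rewrite gK.
  by exists (g v); [exists v|rewrite gK].
exists (fun t i => h (p t i)).
  by rewrite -e; apply: grid_symmetry_valid.
exists t => u v; rewrite -[u]gK -[v]gK -{1 2}e => /(grid_symmetry_burnt _ _ hs).
rewrite -gadj !hK => ub uv.
have [|] := pt _ _ ub uv.
  by left; apply/(grid_symmetry_burnt _ _ hs).
by case=> s st [i _ e']; right; exists s => //; exists i => //; rewrite e'.
Qed.

Definition left_path (w d t : nat) : vertex :=
  (if (t <= 37 * w + 35 * d)%N then (0, t%:Z)
  else if (t <= 38 * w + 36 * d)%N then
    ((2 * (t - (37 * w + 35 * d)))%:Z, (37 * w + 35 * d)%:Z)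
  else if (t <= 54 * w + 50 * d)%N then
    ((t - (36 * w + 34 * d))%:Z, (37 * w + 35 * d)%:Z)
  else ((18 * w + 16 * d)%:Z, (37 * w + 35 * d)%:Z)).

Definition right_path (w d t : nat) : vertex :=
  (if (t <= 17 * w + 16 * d)%N then ((w + t)%:Z, (d + t)%:Z)
  else if (t <= 33 * w + 30 * d)%N then
    ((35 * w + 32 * d - t)%:Z, (d + t)%:Z)
  else if (t <= 35 * w + 32 * d)%N then
    ((2 * w + 2 * d)%:Z, (2 * t - (33 * w + 29 * d))%:Z)
  else if (t <= 37 * w + 34 * d)%N then
    ((37 * w + 34 * d - t)%:Z, (37 * w + 35 * d)%:Z)
  else if (t <= 46 * w + 42 * d)%N then
    ((2 * (t - (37 * w + 34 * d)))%:Z, (37 * w + 35 * d)%:Z)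
  else if (t <= 66 * w + 60 * d)%N then
    ((18 * w + 16 * d)%:Z, (83 * w + 77 * d - t)%:Z)
  else ((18 * w + 16 * d)%:Z, (17 * w + 17 * d)%:Z)).

(** The part of the final wall that is protected by time [t]. The second clause
is the part of the right column that was defended during the corralling. *)
Definition wall (w d t : nat) (v : vertex) : bool :=
  let: (x, y) := v in
  [|| [&& x == 0, 0 <= y, y <= (37 * w + 35 * d)%:Z & y <= t%:Z],
      [&& x == w%:Z, 0 <= y & y <= d%:Z],
      [&& w%:Z <= x, x <= (18 * w + 16 * d)%:Z,
          y - d%:Z == x - w%:Z & y - d%:Z <= t%:Z],
      [&& (2 * w + 2 * d)%:Z <= x, x <= (18 * w + 16 * d)%:Z,
          x + y == (35 * w + 33 * d)%:Z & y - d%:Z <= t%:Z],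
      [&& 0 <= x, x <= (2 * w + 2 * d)%:Z, y == (37 * w + 35 * d)%:Z &
          (37 * w + 34 * d)%:Z - x <= t%:Z],
      [&& (2 * w + 2 * d)%:Z <= x, x <= (18 * w + 16 * d)%:Z,
          y == (37 * w + 35 * d)%:Z &
          (36 * w + 34 * d)%:Z + x <= t%:Z] |
      [&& x == (18 * w + 16 * d)%:Z, (17 * w + 17 * d)%:Z <= y,
          y <= (37 * w + 35 * d)%:Z &
          (83 * w + 77 * d)%:Z - y <= t%:Z]].

(** A bound on the part of the fire above the line [y = 0] at time [t]. The
cells with [2 * w + 2 * d <= x] and [35 * w + 33 * d < x + y] lie on the outer
side of the inward diagonal, so that the fire reaches them around its end
[E = (2 * w + 2 * d, 33 * w + 31 * d)]. *)
Definition zone (w d : nat) (t : nat) (v : vertex) : bool :=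
  let: (x, y) := v in
  [&& 0 < x, x < (18 * w + 16 * d)%:Z, 0 <= y, y < (37 * w + 35 * d)%:Z,
      (x < w%:Z) || (x - w%:Z < y - d%:Z),
      ~~ (((2 * w + 2 * d)%:Z <= x) && (x + y == (35 * w + 33 * d)%:Z)),
      y - x + 1 <= t%:Z, x + y + 1 <= t%:Z + w%:Z + d%:Z
    & ((2 * w + 2 * d)%:Z <= x) && ((35 * w + 33 * d)%:Z < x + y) ==>
      ((65 * w + 61 * d)%:Z + x - y + 1 <= t%:Z)].

Lemma zone_step w d t u v : (0 < w)%N -> (0 < d)%N ->
  zone w d t u -> adj u v -> 0 <= v.2 -> ~~ wall w d t v -> zone w d t.+1 v.
Proof.
case: u => [x y] w0 d0 Z /adjP A; move: Z; rewrite /zone =>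
  /and5P[z1 z2 z3 z4 /and5P[z5 z6 z7 z8 z9]].
case: A => -> /=; rewrite /wall /zone => y0
  /norP[W1 /norP[W2 /norP[W3 /norP[W4 /norP[W5 /norP[W6 W7]]]]]].
all: repeat (apply/andP; split).
- by clear -z1; lia.
- by clear -w0 d0 z2 z4 z5 z6 z8 z9 W3 W7; lia.
- by clear -z3; lia.
- by clear -z4; lia.
- by clear -z2 z3 z5 z8 W2 W3; lia.
- by clear -z2 z8 W4; lia.
- by clear -z7; lia.
- by clear -z8; lia.
- by clear -z6 z8 z9; lia.
- by clear -z1 z3 z4 z7 W1; lia.
- by clear -z2; lia.
- by clear -z3; lia.
- by clear -z4; lia.
- by clear -z5; lia.
- by clear -w0 d0 z2 z9 W4; lia.
- by clear -z7; lia.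
- by clear -z8; lia.
- by clear -z9; lia.
- by clear -z1; lia.
- by clear -z2; lia.
- by clear -z3; lia.
- by clear -z1 z2 z4 z7 z8 W5 W6; lia.
- by clear -z5; lia.
- by clear -z2 z8 W4; lia.
- by clear -z7; lia.
- by clear -z8; lia.
- by clear -z6 z9; lia.
- by clear -z1; lia.
- by clear -z2; lia.
- by clear -y0; lia.
- by clear -z4; lia.
- by clear -z2 z5 z8 W3; lia.
- by clear -w0 d0 z2 z9 W4; lia.
- by clear -z7; lia.
- by clear -z8; lia.
- by clear -z9; lia.
Qed.

Definition free_step (w d t : nat) (u v : vertex) : Prop :=
  exists m, [/\ (m == u) || adj u m, (m == v) || adj m v
    & forall z, z \in [:: u; m; v] -> 0 <= z.2 /\ ~~ zone w d t z].

Lemma left_path_step w d t : (0 < w)%N -> (0 < d)%N ->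
  free_step w d t.+1 (left_path w d t) (left_path w d t.+1).
Proof.
move=> w0 d0; rewrite /left_path.
exists (if (37 * w + 35 * d <= t < 38 * w + 36 * d)%N then
    ((left_path w d t).1 + 1, (left_path w d t).2)
  else left_path w d t).
split.
- by rewrite /left_path /adj; do !case: ifPn => ? //=; apply/orP;
    rewrite -?pair_eqE /=; lia.
- by rewrite /left_path /adj; do !case: ifPn => ? //=; apply/orP;
    rewrite -?pair_eqE /=; lia.
move=> z; rewrite !inE /left_path => /or3P[] /eqP-> {z};
  do !case: ifPn => ? //=; lia.
Qed.

Lemma right_path_step w d t : (0 < w)%N -> (0 < d)%N ->
  free_step w d t.+1 (right_path w d t) (right_path w d t.+1).
Proof.
move=> w0 d0; rewrite /right_path.
exists (if (t < 17 * w + 16 * d)%N ||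
    (37 * w + 34 * d <= t < 46 * w + 42 * d)%N then
    ((right_path w d t).1 + 1, (right_path w d t).2)
  else if (t < 35 * w + 32 * d)%N then
    ((right_path w d t).1, (right_path w d t).2 + 1)
  else right_path w d t).
split.
- by rewrite /right_path /adj; do !case: ifPn => ? //=; apply/orP;
    rewrite -?pair_eqE /=; lia.
- by rewrite /right_path /adj; do !case: ifPn => ? //=; apply/orP;
    rewrite -?pair_eqE /=; lia.
move=> z; rewrite !inE /right_path => /or3P[] /eqP-> {z};
  do !case: ifPn => ? //=; lia.
Qed.

Lemma wall_visited w d t v : (0 < w)%N -> (0 < d)%N -> wall w d t v ->
  (v.1 = w%:Z /\ 0 <= v.2 <= d%:Z) \/
  exists2 s, (s <= t)%N & left_path w d s = v \/ right_path w d s = v.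
Proof.
case: v => x y w0 d0; rewrite /wall.
case/or4P=> [||| /or4P[|||]] W.
- right; exists `|y|%N; first lia.
  by left; rewrite /left_path ifT; [congr pair|]; lia.
- by left=> /=; lia.
- right; exists `|y - d%:Z|%N; first lia.
  by right; rewrite /right_path ifT; [congr pair|]; lia.
- right; exists `|y - d%:Z|%N; first lia.
  right; rewrite /right_path; do !case: ifPn => ? //; congr pair; lia.
- right; exists `|(37 * w + 34 * d)%:Z - x|%N; first lia.
  right; rewrite /right_path; do !case: ifPn => ? //; congr pair; lia.
- right; exists (36 * w + 34 * d + `|x|)%N; first lia.
  left; rewrite /left_path; do !case: ifPn => ? //; congr pair; lia.
- right; exists `|(83 * w + 77 * d)%:Z - y|%N; first lia.
  right; rewrite /right_path; do !case: ifPn => ? //; congr pair; lia.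
Qed.

Definition relative_to (o v : vertex) : vertex := (v.1 - o.1, v.2 - o.2).
Definition shift (o v : vertex) : vertex := (o.1 + v.1, o.2 + v.2).

Lemma shiftK o : cancel (shift o) (relative_to o).
Proof.
by case: o => a b [x y]; rewrite /relative_to /shift /=; congr pair; lia.
Qed.

Lemma relative_toK o : cancel (relative_to o) (shift o).
Proof.
by case: o => a b [x y]; rewrite /relative_to /shift /=; congr pair; lia.
Qed.

Lemma adj_shift o u v : adj (shift o u) (shift o v) = adj u v.
Proof. by case: o u v => a b [x y] [x' y']; rewrite /adj /shift /=; lia. Qed.

Lemma adj_relative_to o u v : adj (relative_to o u) (relative_to o v) = adj u v.
Proof. by rewrite -(adj_shift o) !relative_toK. Qed.

Lemma zone_mono w d s t v : (s <= t)%N -> zone w d s v -> zone w d t v.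
Proof.
case: v => x y st; rewrite /zone => /and5P[-> -> -> ->
  /and5P[-> -> z1 z2 z3]] /=; lia.
Qed.

(** Below the row of [o] the fire stays in [A], whose boundary is already
protected at time [T] except for the opening between the two columns. *)
Section Capture.
Variables (S : set vertex) (p : strategy) (T : nat) (l : 'I_2) (o : vertex).
Variables (w d : nat) (A : set vertex) (n : nat).
Hypotheses (pv : valid S p) (w0 : (0 < w)%N) (d0 : (0 < d)%N).
Hypothesis pl : p T l = o.
Hypothesis pr : forall i : 'I_2, i != l -> p T i = shift o (w%:Z, d%:Z).
Hypothesis rwall : forall y : int, 0 <= y <= d%:Z ->
  protected p T (shift o (w%:Z, y)).
Hypothesis Abox : A `<=` in_box n.
Hypothesis Alow : forall v, A v -> (relative_to o v).2 < 0.
Hypothesis Aclosed : forall u v, A u -> adj u v -> ~ protected p T v ->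
  A v \/ zone w d 0 (relative_to o v).
Hypothesis Agate : forall x : int, 0 < x < w%:Z ->
  ~ protected p T (shift o (x, -1)) -> A (shift o (x, -1)).
Hypothesis Aburnt : forall v, burnt S p T v ->
  A v \/ zone w d 0 (relative_to o v).

Let q : strategy := fun t i => if (t <= T)%N then p t i else
  shift o ((if i == l then left_path else right_path) w d (t - T)%N).

Let q_after t i : q (T + t)%N i =
  shift o ((if i == l then left_path else right_path) w d t).
Proof.
rewrite /q; case: leqP => [tT|_]; last by rewrite addKn.
have -> : t = 0%N by lia.
rewrite addn0; case: eqP => [->|/eqP/pr->].
  by rewrite pl /left_path /shift /=; case: (o) => x y /=; congr pair; lia.
by rewrite /right_path /= !addn0.
Qed.

Let q_before t : (t <= T)%N -> burnt S q t = burnt S p t.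
Proof.
by move=> tT; apply: burnt_congr => s i st;
  rewrite /q ifT // ltnW // (leq_trans st).
Qed.

Let protected_before t : protected p T `<=` protected q (T + t)%N.
Proof.
move=> v [s sT [i _ <-]]; exists s; first by rewrite (leq_trans sT) ?leq_addr.
by exists i => //; rewrite /q sT.
Qed.

Let protected_wall t v : wall w d t (relative_to o v) ->
  protected q (T + t)%N v.
Proof.
move=> /(wall_visited w0 d0) [[vx vy]|[s st vs]].
  apply: protected_before; rewrite -[v](relative_toK o).
  by move: vx vy; case: (relative_to o v) => x y /= ->; apply: rwall.
exists (T + s)%N; first by rewrite leq_add2l.
case: vs => vs.
  by exists l => //; rewrite q_after eqxx vs relative_toK.
have [i il] : exists i : 'I_2, i != l.
  by exists (if l == 0 then 1 else 0); case: (l) => -[|[|?]].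
by exists i => //; rewrite q_after (negbTE il) vs relative_toK.
Qed.

Let burnt_after t v : burnt S q (T + t)%N v ->
  A v \/ zone w d t (relative_to o v).
Proof.
elim: t v => [|t IH] v; first by rewrite addn0 q_before //; apply: Aburnt.
rewrite addnS => -[/IH[|z]|]; first by left.
  by right; apply: zone_mono z.
case=> np [u ub uv].
have [Au|zu] := IH _ ub.
  have [|/zone_mono z] := Aclosed Au uv (contra_not (@protected_before t v) np).
    by left.
  by right; apply: z.
have [v0|v0] := leP 0 (relative_to o v).2.
  right; apply: zone_step zu _ v0 _ => //; first by rewrite adj_relative_to.
  by apply/negP => /protected_wall.
left; move: np uv zu v0; rewrite -[v](relative_toK o).
rewrite -(adj_relative_to o) !shiftK.
case: (relative_to o u) (relative_to o v) => x y [x' y'] np uv zu /= v0.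
have [y1 x0 xw] : [/\ y' = -1, 0 < x' & x' < w%:Z].
  by move: uv zu; rewrite /adj /zone /= => uv zu; split; lia.
move: np; rewrite y1 => np; apply: Agate; first by rewrite x0 xw.
by move=> /(@protected_before t).
Qed.

Let q_valid : valid S q.
Proof.
split=> [i|t i]; first by rewrite /q leq0n; apply: pv.1.
have [tT|Tt] := ltnP t T.
  by rewrite q_before // /q tT ltnW //; apply: pv.2.
rewrite -(subnKC Tt) -addnS !q_after.
set s := (t - T)%N.
have [m [um mv mz]] : free_step w d s.+1
    ((if i == l then left_path else right_path) w d s)
    ((if i == l then left_path else right_path) w d s.+1).
  by case: eqP => _; [apply: left_path_step|apply: right_path_step].
have unburnt z : 0 <= z.2 /\ ~~ zone w d s.+1 z ->
  (~` burnt S q (T + s.+1)%N) (shift o z).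
  move=> [z0 zz] /burnt_after [/Alow|]; rewrite shiftK; last exact/negP.
  by rewrite ltNge z0.
apply: (@dist_le_via _ _ (shift o m)).
- by apply/unburnt/mz; rewrite !inE eqxx.
- by apply/unburnt/mz; rewrite !inE eqxx orbT.
- by apply/unburnt/mz; rewrite !inE eqxx !orbT.
- by rewrite adj_shift (can_eq (shiftK o)).
- by rewrite adj_shift (can_eq (shiftK o)).
Qed.

Lemma capture : can_contain S.
Proof.
pose N := (maxn n (`|o.1| + `|o.2| + 37 * w + 35 * d))%N.
apply: (@contain_bounded S q N); first exact: q_valid.
move=> t v /(burnt_mono (leq_addl T t)) /burnt_after [/Abox|].
  by apply: in_box_le; rewrite leq_maxl.
rewrite /in_box /N; case: (o) v => a b [x y] /= z; split; lia.
Qed.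

End Capture.

Section Corral.
Variables (S : set vertex) (p : strategy) (T : nat) (x0 x1 y0 y1 : int).
Hypotheses (pv : valid S p) (x01 : x0 < x1) (y01 : y0 < y1).
Hypothesis pT : forall t : nat,
  defended p (T + t) = [set (x0, y0 + t%:Z); (x1, y1 + t%:Z)].
Hypothesis confined : forall (t : nat) (x y : int),
  (~~ (x0 <= x <= x1) /\ y1 < y) \/ y < y0 ->
  ~ burnt S p T (x, y) -> ~ burnt S p t (x, y).

Let ever_burnt v := exists t, burnt S p t v.

Let spread u v : ever_burnt u -> adj u v -> (forall s i, p s i <> v) ->
  ever_burnt v.
Proof.
move=> [t ut] uv nv; exists t.+1; right; split; last by exists u.
by move=> [s _ [i _]]; apply: nv.
Qed.

Let on_column s i (x y : int) : (T <= s)%N -> p s i = (x, y) ->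
  (x = x0 /\ y = y0 + s%:Z - T%:Z) \/ (x = x1 /\ y = y1 + s%:Z - T%:Z).
Proof.
move=> Ts psi; have : defended p s (x, y) by exists i.
by rewrite -(subnKC Ts) pT => -[] [-> ->]; [left|right]; split=> //; lia.
Qed.

Let column_visited (t : nat) : (exists i, p (T + t)%N i = (x0, y0 + t%:Z)) /\
  (exists i, p (T + t)%N i = (x1, y1 + t%:Z)).
Proof.
have [] : defended p (T + t) (x0, y0 + t%:Z) /\
    defended p (T + t) (x1, y1 + t%:Z).
  by rewrite pT; split; [left|right].
by move=> [i _ e] [j _ f]; split; [exists i|exists j].
Qed.

Variable N : nat.
Hypotheses (burntN : burnt S p T `<=` in_box N)
  (positionN : forall s i, (s <= T)%N -> in_box N (p s i)).
Hypotheses (x0N : `|x0| <= N%:Z) (x1N : `|x1| <= N%:Z) (y0N : `|y0| <= N%:Z)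
  (y1N : `|y1| <= N%:Z).

Let ever_position s i (x y : int) : p s i = (x, y) ->
  (`|x| <= N%:Z /\ `|y| <= N%:Z) \/
  [/\ (T <= s)%N & (x = x0 /\ y = y0 + s%:Z - T%:Z) \/
    (x = x1 /\ y = y1 + s%:Z - T%:Z)].
Proof.
move=> psi; have [sT|Ts] := leqP s T.
  by left; move: (positionN i sT); rewrite psi.
by right; split; [exact: ltnW|apply: (on_column (i := i)) psi; exact: ltnW].
Qed.

Let outside (x y : int) : N%:Z < y -> ~~ (x0 <= x <= x1) -> ~ ever_burnt (x, y).
Proof.
move=> Ny xx [t]; apply: confined; first by left; split=> //; lia.
by move=> /burntN [/= _]; lia.
Qed.

Let above (x y : int) : N%:Z < y -> ever_burnt (x, y) -> x0 < x < x1.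
Proof.
move=> Ny Kxy; have [xx|/(outside Ny)//] := boolP (x0 <= x <= x1).
have [e|xnx0] := eqVneq x x0.
  have /(outside Ny) : ~~ (x0 <= x - 1 <= x1) by lia.
  case; apply: spread Kxy _ _; first by rewrite /adj /=; lia.
  by move=> s i /ever_position; lia.
have [e|xnx1] := eqVneq x x1; last by lia.
have /(outside Ny) : ~~ (x0 <= x + 1 <= x1) by lia.
case; apply: spread Kxy _ _; first by rewrite /adj /=; lia.
by move=> s i /ever_position; lia.
Qed.

(** A fire outside both columns would climb its own unprotected column. *)
Let below (x y : int) : y <= N%:Z -> ever_burnt (x, y) -> in_box N (x, y).
Proof.
move=> yN Kxy; have [xN|Nx] := leP `|x| N%:Z.
  split=> //=; have [yy|yy] := ltP y y0; last by lia.
  have [/burntN [] //|nb] := EM (burnt S p T (x, y)).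
  by case: Kxy => t /confined; case=> //; right.
have up (k : nat) : ever_burnt (x, y + k%:Z).
  elim: k => [|k IH]; first by rewrite addr0.
  apply: spread IH _ _; first by rewrite /adj /=; lia.
  by move=> s i /ever_position; lia.
have := up `|(N%:Z + 1 - y)%R|%N => /above; lia.
Qed.

Let left_time t (x y : int) : N%:Z < y -> burnt S p t (x, y) ->
  T%:Z + (y - y0) - (x - x0) + 1 <= t%:Z.
Proof.
move=> Ny bt; have xx : x0 < x < x1 by apply: above Ny _; exists t.
have side (k : nat) : x0 < x - k%:Z -> burnt S p (t + k)%N (x - k%:Z, y).
  elim: k => [|k IH] xk; first by rewrite addn0 subr0.
  rewrite addnS; right; split.
    by move=> [s _ [i _ /ever_position]]; lia.
  by exists (x - k%:Z, y); [apply: IH; lia|rewrite /adj /=; lia].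
have := side `|(x - x0 - 1)%R|%N; set k := `|_|%N => bk.
have [[s sk [i _ /ever_position]]|np] := EM (protected p (t + k)%N (x0, y));
  first by lia.
have /(above Ny) : ever_burnt (x0, y); last by lia.
exists (t + k).+1; right; split=> //; exists (x - k%:Z, y);
  first by apply: bk; lia.
by rewrite /adj /=; lia.
Qed.

Let right_time t (x y : int) : N%:Z < y -> burnt S p t (x, y) ->
  T%:Z + (y - y1) - (x1 - x) + 1 <= t%:Z.
Proof.
move=> Ny bt; have xx : x0 < x < x1 by apply: above Ny _; exists t.
have side (k : nat) : x + k%:Z < x1 -> burnt S p (t + k)%N (x + k%:Z, y).
  elim: k => [|k IH] xk; first by rewrite addn0 addr0.
  rewrite addnS; right; split.
    by move=> [s _ [i _ /ever_position]]; lia.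
  by exists (x + k%:Z, y); [apply: IH; lia|rewrite /adj /=; lia].
have := side `|(x1 - x - 1)%R|%N; set k := `|_|%N => bk.
have [[s sk [i _ /ever_position]]|np] := EM (protected p (t + k)%N (x1, y));
  first by lia.
have /(above Ny) : ever_burnt (x1, y); last by lia.
exists (t + k).+1; right; split=> //; exists (x + k%:Z, y);
  first by apply: bk; lia.
by rewrite /adj /=; lia.
Qed.

Let flow (x y x' y' : int) : ever_burnt (x, y) -> adj (x, y) (x', y') ->
  x0 < x' < x1 -> N%:Z < y' -> ever_burnt (x', y').
Proof.
move=> Kxy xy xx Ny; apply: spread Kxy xy _.
by move=> s i /ever_position; lia.
Qed.

Let flood (x y x' : int) : N%:Z < y -> ever_burnt (x, y) -> x0 < x' < x1 ->
  ever_burnt (x', N%:Z + 1).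
Proof.
move=> Ny Kxy xx'; have xx := above Ny Kxy.
have {y Ny Kxy} Kx : ever_burnt (x, N%:Z + 1).
  have [k ky] : exists k : nat, y = N%:Z + 1 + k%:Z.
    by exists `|(y - N%:Z - 1)%R|%N; lia.
  elim: k y ky Ny Kxy => [|k IH] y ky Ny Kxy.
    by move: Kxy; rewrite ky addr0.
  apply: (IH (y - 1)); [by lia|by lia|].
  by apply: flow Kxy _ xx _; rewrite ?/adj /=; lia.
have [k kx] : exists k : nat, `|x - x'| = k%:Z by exists `|(x - x')%R|%N; lia.
elim: k x xx kx Kx => [|k IH] x xx kx Kx.
  by have -> : x' = x by lia.
have [xl|xl] := ltP x x'.
  apply: (IH (x + 1)); [by lia|by lia|].
  by apply: flow Kx _ _ _; rewrite ?/adj /=; lia.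
apply: (IH (x - 1)); [by lia|by lia|].
by apply: flow Kx _ _ _; rewrite ?/adj /=; lia.
Qed.

Let M := `|(N%:Z + 1 - y0)%R|%N.

Let ever_protected s i (x y : int) : p s i = (x, y) -> y <= N%:Z + 1 ->
  protected p (T + M)%N (x, y).
Proof.
move=> psi yN; exists s; last by exists i.
have [|Ts] := leqP s T; first by rewrite /M; lia.
by have := on_column (ltnW Ts) psi; rewrite /M; lia.
Qed.

Let unprotected_burns u (x y : int) : ever_burnt u -> adj u (x, y) ->
  y <= N%:Z + 1 -> ~ protected p (T + M)%N (x, y) -> ever_burnt (x, y).
Proof.
move=> Ku uv yN np; apply: spread Ku uv _ => s i /ever_protected pxy.
exact: np (pxy yN).
Qed.

Lemma corral_capture : can_contain S.
Proof.
have [[v [Kv vN]]|low] := EM (exists v : vertex, ever_burnt v /\ N%:Z < v.2);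
  last first.
  apply: (contain_bounded pv (n := N)) => t [x y] b.
  apply: below; last by exists t.
  rewrite leNgt; apply/negP => Ny; apply: low.
  by exists (x, y); split=> //; exists t.
have [[l pl] [r pr]] := column_visited M.
have yM : y0 + M%:Z = N%:Z + 1 by rewrite /M; lia.
pose w := `|(x1 - x0)%R|%N; pose d := `|(y1 - y0)%R|%N.
pose A := [set v : vertex | ever_burnt v /\ v.2 <= N%:Z].
apply: (@capture S p (T + M)%N l (x0, N%:Z + 1) w d A N) => //.
- by rewrite /w; lia.
- by rewrite /d; lia.
- by rewrite pl yM.
- move=> i il; have -> : i = r.
    have rl : r != l by apply/eqP => rl; move: pl; rewrite -rl pr => -[]; lia.
    apply/val_inj; move: il rl; rewrite -!val_eqE /=.
    by case: i l r {pl pr} => [i ?] [j ?] [k ?] /=; lia.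
  by rewrite pr /shift /w /d /=; congr pair; lia.
- move=> y yd; rewrite /shift /=.
  have [_ [i e]] := column_visited `|(N%:Z + 1 + y - y1)%R|%N.
  exists (T + `|(N%:Z + 1 + y - y1)%R|)%N; first by rewrite /M; lia.
  by exists i => //; rewrite e /w; congr pair; lia.
- by move=> [x y] [Kxy yN]; apply: below.
- by move=> [x y] [_ /=]; lia.
- move=> u [x y] [Ku uN] uv np.
  have yN : y <= N%:Z + 1.
    by case: u uN uv {Ku} => a b /= uN; rewrite /adj /=; lia.
  have K := unprotected_burns Ku uv yN np.
  have [yle|ylt] := leP y N%:Z; [by left|right].
  by have := above ylt K; rewrite /zone /relative_to /= /w /d; lia.
- move=> x xw np; case: v Kv vN => a b Kv vN.
  have Kx : ever_burnt (x0 + x, N%:Z + 1).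
    by apply: flood vN Kv _; rewrite /w in xw; lia.
  split; last by rewrite /shift /=; lia.
  by apply: unprotected_burns Kx _ _ np; rewrite ?/adj /=; lia.
move=> [x y] b; have K : ever_burnt (x, y) by exists (T + M)%N.
have [yle|ylt] := leP y N%:Z; [by left|right].
have := above ylt K; have := left_time ylt b; have := right_time ylt b.
by rewrite /zone /relative_to /= /w /d /M; lia.
Qed.

End Corral.

Theorem theorem3p2 (S : set vertex) (Sfin : finite_set S) (Sne : S !=set0) :
  can_corral S -> can_contain S.
Proof.
move=> [p [g [T [x0 [x1 [y0 [y1 [pv gs [x01 y01] gp gb]]]]]]]].
apply: (grid_symmetry_contain gs).
pose q t i := g (p t i).
have gSfin : finite_set (g @` S) by apply: finite_image.
have [n1 n1P] := burnt_in_box q T gSfin.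
have [n2 n2P] := positions_in_box q T.
pose N := (n1 + n2 + `|x0| + `|x1| + `|y0| + `|y1|)%N.
apply: (@corral_capture _ q T x0 x1 y0 y1 _ _ _ _ _ N) => //.
- exact: grid_symmetry_valid.
- by move=> t; rewrite -gp /defended /q -image_comp.
- move=> t x y xy; have [[h gK hK] _] := gs.
  by rewrite -[(x, y)]hK !(grid_symmetry_burnt S p gs); apply: gb xy;
    rewrite hK.
- by apply: subset_trans n1P _; apply: in_box_le; rewrite /N; lia.
- by move=> s i /(n2P s i); apply: in_box_le; rewrite /N; lia.
all: by rewrite /N; lia.
Qed.
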